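(* Let $\Delta\subset\mathbb{R}^n$ be an open neighbourhood of the origin and let $f:\Delta\to\mathbb{R}^n$ be of class $\mathcal{C}^1$ with $f(0)=0$. Let $U\subset\mathbb{R}^n$ be an open set with $\overline{U}\subset\Delta$ and $0\in\partial U$, and let $V,W:\Delta\to\mathbb{R}$ be functions of class $\mathcal{C}^1$ such that: (i) $\dot V(x)<0$ if $x\in\overline{U}\setminus\{0\}$; (ii) $W(x)<0$ if $x\in U$; (iii) $W(x)=0$ if $x\in\partial U$; (iv) $\dot W(x)\le 0$ if $x\in U$. Then there exists a nonconstant trajectory $x(t)$ of $\dot x=f(x)$, defined for all $t\le 0$, such that $\lim_{t\to-\infty}x(t)=0$.
   Context: For a $\mathcal{C}^1$ function $V:\Delta\to\mathbb{R}$, $\dot V(x)=\langle\nabla V(x),f(x)\rangle$ denotes the derivative of $V$ along the solutions of $\dot x=f(x)$; similarly for $\dot W$. *)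

(* Defs.v *)
From HB Require Import structures.
From mathcomp Require Import all_boot all_order all_algebra.
From mathcomp Require Import all_classical all_reals all_analysis.

Set Implicit Arguments.
Unset Strict Implicit.
Unset Printing Implicit Defensive.

Import Order.TTheory GRing.Theory Num.Theory.
Import numFieldNormedType.Exports.

Local Open Scope classical_set_scope.
Local Open Scope ring_scope.

(* R^n is 'rV[R]_n. Maps "on Delta" are total functions; every notion below,
   evaluated at a point of an open set D, depends only on the values on D. *)

Definition boundary (T : topologicalType) (A : set T) : set T :=
  closure A `\` interior A.

Definition partial (R : realType) (n : nat) (V : normedModType R)
    (j : 'I_n) (g : 'rV[R]_n -> V) : 'rV[R]_n -> V :=
  fun x => 'D_(delta_mx 0 j) g x.

(* Meant for open D: continuity of the partial derivatives is then the same
   in D as in R^n. *)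
Definition C1_on (R : realType) (n : nat) (V : normedModType R)
    (D : set 'rV[R]_n) (g : 'rV[R]_n -> V) : Prop :=
  forall x, D x ->
    differentiable g x /\ forall j : 'I_n, {for x, continuous (partial j g)}.

Definition grad (R : realType) (n : nat) (V : 'rV[R]_n -> R) (x : 'rV[R]_n) :
    'rV[R]_n :=
  \row_j partial j V x.

Definition dotp (R : realType) (n : nat) (u v : 'rV[R]_n) : R :=
  \sum_j u 0 j * v 0 j.

Definition orbital_derivative (R : realType) (n : nat)
    (f : 'rV[R]_n -> 'rV[R]_n) (V : 'rV[R]_n -> R) (x : 'rV[R]_n) : R :=
  dotp (grad V x) (f x).

(* Only the values of x on J are relevant, except that the derivative at an
   endpoint of J is two-sided. This loses nothing: a one-sided derivative there
   becomes two-sided once x is continued affinely outside J. *)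
Definition trajectory_on (R : realType) (n : nat) (D : set 'rV[R]_n)
    (f : 'rV[R]_n -> 'rV[R]_n) (J : interval R) (x : R -> 'rV[R]_n) : Prop :=
  forall t, t \in J -> D (x t) /\ is_derive t 1 x (f (x t)).

(* Main.v *)
Require Import Defs.
From HB Require Import structures.
From mathcomp Require Import all_boot all_order all_algebra.
From mathcomp Require Import all_classical all_reals all_analysis.
From mathcomp Require Import ring lra.

Import Order.TTheory GRing.Theory Num.Theory.
Import numFieldNormedType.Exports.

Local Open Scope classical_set_scope.
Local Open Scope ring_scope.

Set Implicit Arguments.
Unset Strict Implicit.
Unset Printing Implicit Defensive.

(** Points of [U] near the origin cannot leave [U] forward in time, because [W]
is negative and nonincreasing inside [U] and vanishes on its boundary.  Nor can
they stay in a small closed ball [B] around the origin: the bound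
[W <= W p < 0] keeps the orbit of [p] away from [0], where [W] vanishes, so [V]
decreases at a rate bounded away from zero, although it is bounded on the
compact set of points of [closure U] in [B].  Hence the orbit of every such [p]
meets the sphere bounding [B], after remaining in [U] and in [B] up to that
time (lemma [exit_through_sphere]).

As [p] tends to [0] the exit time tends to infinity, since orbits separate at
most exponentially ([gronwall]) and [0] is an equilibrium.  By compactness the
exit points accumulate at some [y] on the sphere, and by continuous dependence
on the initial point the whole backward orbit of [y] lies in [closure U] and
in [B] (lemma [backward_limit]).  Along that orbit [V] is monotone and bounded.
If the orbit did not tend to [0] when [t] tends to [-oo], it would be outside
some fixed ball at arbitrarily negative times, hence, again by [gronwall],
outside a smaller ball during unit intervals of time, over each of which [V]
loses a fixed amount; this is impossible (lemma [backward_convergence]).  The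
trajectory is not constant since [y] is not [0].

Solutions are taken for the field [f \o clamp r], where [clamp r] is the
1-Lipschitz retraction of the space onto the ball of radius [r] (a cube, for the
supremum norm).  This field is globally Lipschitz and agrees with [f] on the
ball, so its solutions exist for all times ([global_existence]) and are
solutions of the original equation as long as they stay in the ball. *)

(** * Rows and the supremum norm *)

Lemma coord_le_norm (R : realType) n (v : 'rV[R]_n) i : `|v 0 i| <= `|v|.
Proof.
rewrite [leRHS]/Num.Def.normr/= mx_normrE.
exact: (le_bigmax _ (fun k : 'I_1 * 'I_n => `|v k.1 k.2|) (0, i)).
Qed.

Lemma norm_le_coord (R : realType) n (v : 'rV[R]_n) e :
  0 <= e -> (forall i, `|v 0 i| <= e) -> `|v| <= e.
Proof.
move=> e0 h; rewrite [leLHS]/Num.Def.normr/= mx_normrE.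
by apply: bigmax_le => //= -[i j] _ /=; rewrite (ord1 i).
Qed.

Lemma is_derive_rowP (R : realType) n (x : R -> 'rV[R]_n) (t : R) v :
  is_derive t 1 x v <-> forall i, is_derive t 1 (fun s => x s 0 i) (v 0 i).
Proof.
split=> [[dx xv] i|h].
  split; first exact: ((derivable_mxP x t 1).1 dx).
  by rewrite -xv derive_mx// mxE.
have dx : derivable x t 1.
  by apply/derivable_mxP => j i; rewrite (ord1 j); have [] := h i.
split=> //; rewrite derive_mx//; apply/rowP => i; rewrite mxE.
by have [] := h i.
Qed.

Lemma is_derive_continuous (R : realType) (V : normedModType R) (x : R -> V) (t : R) v :
  is_derive t 1 x v -> {for t, continuous x}.
Proof.
by move=> [dx _]; apply/differentiable_continuous/derivable1_diffP.
Qed.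

Lemma row_nbhsP (R : realType) n (u : 'rV[R]_n) (A : set 'rV[R]_n) :
  nbhs u A <-> exists2 e : R, 0 < e & forall v, `|u - v| < e -> A v.
Proof.
split.
  by move=> /(@nbhs_normP R 'rV[R]_n u A)[e e0 h]; exists e.
by move=> [e e0 h]; apply/(@nbhs_normP R 'rV[R]_n u A); exists e.
Qed.

(** * Increments and antiderivatives of real functions *)

(** The mean value theorem applied to [v - u]: this is how every bound on a
derivative is turned below into a bound on the function. *)
Lemma ler_increment (R : realType) (u v du dv : R -> R) (a b : R) :
  a <= b ->
  (forall t : R, a <= t <= b -> is_derive t 1 u (du t)) ->
  (forall t : R, a <= t <= b -> is_derive t 1 v (dv t)) ->
  (forall t : R, a < t < b -> du t <= dv t) ->
  u b - u a <= v b - v a.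
Proof.
rewrite le_eqVlt => /predU1P[<-|ab] hu hv huv; first by rewrite !subrr.
have hw (t : R) : a <= t <= b -> is_derive t 1 (v - u) (dv t - du t).
  by move=> tab; apply: is_deriveB; [exact: hv|exact: hu].
have [t||t tab] := @MVT R (v - u) (dv - du) a b ab.
  by rewrite in_itv/= => /andP[/ltW ? /ltW ?]; apply: hw; apply/andP.
  apply: continuous_in_subspaceT => s; rewrite inE/= in_itv/= => sab.
  by have := is_derive_continuous (hw _ sab).
rewrite !fctE -[_ - _ in LHS]/(_ - _) => e.
have : 0 <= (dv t - du t) * (b - a).
  apply: mulr_ge0; first by rewrite subr_ge0; apply: huv; move: tab; rewrite in_itv.
  by rewrite subr_ge0 ltW.
rewrite -e; lra.
Qed.

Lemma is_derive_comp_opp (R : realType) (u : R -> R) (t d : R) :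
  is_derive (- t) 1 u d -> is_derive t 1 (fun s => u (- s)) (- d).
Proof.
move=> h; have := @is_derive1_comp R u -%R t d (-1) h (is_deriveNid t 1).
by rewrite mulrN1.
Qed.

(** An integral from [-1] has derivative [g] only to the right of
[-1]; two such functions, one of them run backwards, are glued at [0] in
[antiderivative]. *)
Lemma antiderivative_gtN1 (R : realType) (g : R -> R) : continuous g ->
  exists F : R -> R, forall t : R, -1 < t -> is_derive t 1 F (g t).
Proof.
move=> cg; exists (fun x => \int[lebesgue_measure]_(t in [set` `[(-1), x]]) (g t))%R.
move=> t t1; have tt : t < t + 1 by rewrite ltrDl.
have [|||d e] := @continuous_FTC1_closed R g (-1) t (t + 1) tt => //.
- apply: continuous_compact_integrable; first exact: segment_compact.
  exact: continuous_subspaceT.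
- exact: cg.
- by split => //; rewrite -derive1E e.
Qed.

(** An antiderivative [F] of [g] on ]-1, +oo[ and one [K] on ]-oo, 1[, obtained
from an antiderivative of [fun s => - g (- s)], differ by a constant
on ]-1, 1[.  Normalized to vanish at [0] they coincide there, so that the
function glued at [0] agrees with one of them in a neighbourhood of every point. *)
Lemma antiderivative (R : realType) (g : R -> R) : continuous g ->
  exists G : R -> R, G 0 = 0 /\ forall t : R, is_derive t 1 G (g t).
Proof.
move=> cg; have [F hF] := antiderivative_gtN1 cg.
have [|H hH] := @antiderivative_gtN1 R (fun s => - g (- s)).
  by move=> t; apply: continuousN;
    apply: continuous_comp; [exact: opp_continuous|exact: cg].
pose K t := H (- t).
have hK (t : R) : t < 1 -> is_derive t 1 K (g t).
  move=> t1; have := hH (- t); rewrite ltrN2 => /(_ t1) /is_derive_comp_opp.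
  by rewrite !opprK.
have FK (t : R) : -1 < t < 1 -> F t - F 0 = K t - K 0.
  move=> /andP[t1 t2]; have [t0|/ltW t0] := leP 0 t.
    apply/eqP; rewrite eq_le; apply/andP; split;
    apply: (@ler_increment R _ _ g g) => // s /andP[s1 s2];
    by [apply: hF; lra|apply: hK; lra].
  suff : F 0 - F t = K 0 - K t by lra.
  by apply/eqP; rewrite eq_le; apply/andP; split;
    apply: (@ler_increment R _ _ g g) => // s /andP[s1 s2];
    by [apply: hF; lra|apply: hK; lra].
pose G t := if 0 <= t then F t - F 0 else K t - K 0.
exists G; split; first by rewrite /G lexx subrr.
move=> t; have [t0|t0] := ltP (-1) t.
  apply: (@near_eq_is_derive _ _ _ (F - cst (F 0))).
  - near=> s; rewrite /G !fctE/=; case: ifPn => //; rewrite -ltNge => s0.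
    apply: FK; apply/andP; split; last lra.
    by near: s; exact: lt_nbhsr.
  - by rewrite -[g t]subr0; apply: is_deriveB; exact: hF.
apply: (@near_eq_is_derive _ _ _ (K - cst (K 0))).
- near=> s; rewrite /G !fctE/=; case: ifPn => // s0.
  apply/esym; apply: FK; apply/andP; split; first lra.
  by near: s; apply: lt_nbhsl; lra.
- by rewrite -[g t]subr0; apply: is_deriveB; apply: hK; lra.
Unshelve. all: by end_near. Qed.

(** The exponential weight makes Picard iteration contracting on the whole line
at once: when the weight [expR (k * `|t|)] is integrated, a factor [k] is
gained. *)
Lemma ler_norm_expR_derive (R : realType) (u du : R -> R) (C k : R) :
  0 <= C -> 0 <= k -> u 0 = 0 -> (forall t : R, is_derive t 1 u (du t)) ->
  (forall t, `|du t| <= C * (k * expR (k * `|t|))) ->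
  forall t, `|u t| <= C * expR (k * `|t|).
Proof.
move=> C0 k0.
suff pos (w dw : R -> R) : w 0 = 0 -> (forall t : R, is_derive t 1 w (dw t)) ->
  (forall t, `|dw t| <= C * (k * expR (k * `|t|))) ->
  forall t, 0 <= t -> `|w t| <= C * expR (k * `|t|).
  move=> u0 hu bu t; have [t0|/ltW t0] := leP 0 t; first exact: (pos u du).
  have := pos (fun s => u (- s)) (fun s => - du (- s)) _ _ _ (- t).
  rewrite opprK normrN; apply.
  - by rewrite oppr0.
  - by move=> s; apply: is_derive_comp_opp; exact: hu.
  - by move=> s; rewrite normrN -[`|s|]normrN; exact: bu.
  - by rewrite oppr_ge0.
move=> w0 hw bw t t0; rewrite (ger0_norm t0).
pose E s := C * expR (k * s).
have hE (s : R) : is_derive s 1 E (C * (k * expR (k * s))).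
  apply: is_deriveZ; rewrite mulrC.
  apply: (@is_derive1_comp R expR (fun s => k * s)).
  have := @is_deriveZ R _ _ id k s 1 1 _; rewrite /GRing.scale/= mulr1; exact.
have h1 : w t - w 0 <= E t - E 0.
  apply: (@ler_increment _ w E dw (fun s => C * (k * expR (k * s)))) => // s s0.
  by rewrite (le_trans (ler_norm _))// (le_trans (bw _))// ger0_norm//; lra.
have h2 : - w t - - w 0 <= E t - E 0.
  apply: (@ler_increment _ (- w) E (- dw) (fun s => C * (k * expR (k * s)))) => // s s0.
  rewrite (le_trans (ler_norm _))// normrN (le_trans (bw _))// ger0_norm//; lra.
move: h1 h2; rewrite /E w0 mulr0 expR0 ler_norml => h1 h2; apply/andP; split; lra.
Qed.

(** Taking [l] to be the supremum of the lower bounds [u j - 2 * C / 2 ^+ j]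
yields the limit together with its rate of convergence, since each of these
lower bounds is below all the upper bounds [u m + 2 * C / 2 ^+ m]. *)
Lemma geometric_limit (R : realType) (u : nat -> R) (C : R) :
  (forall j, `|u j.+1 - u j| <= C / 2 ^+ j) ->
  exists l, forall j, `|u j - l| <= 2 * C / 2 ^+ j.
Proof.
move=> hu.
have step j m : `|u (j + m)%N - u j| <= 2 * C / 2 ^+ j - 2 * C / 2 ^+ (j + m).
  elim: m => [|m IH]; first by rewrite addn0 !subrr normr0.
  rewrite addnS; set a := u _; rewrite -(subrK (u (j + m)%N) a) -addrA.
  apply: (le_trans (ler_normD _ _)); apply: (le_trans (lerD (hu _) IH)).
  rewrite exprS invfM; set z := (2 ^+ _)^-1; lra.
have C0 j : 0 <= C / 2 ^+ j by apply: le_trans (hu j).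
pose e j := 2 * C / 2 ^+ j.
have e0 j : 0 <= e j by rewrite /e -mulrA mulr_ge0.
have cmp j m : u j - e j <= u m + e m.
  have [jm|/ltnW mj] := leqP j m.
    move: (step j (m - j)%N) (e0 m); rewrite subnKC// -!/(e _) ler_norml.
    by move=> /andP[? ?] ?; lra.
  move: (step m (j - m)%N) (e0 j); rewrite subnKC// -!/(e _) ler_norml.
  by move=> /andP[? ?] ?; lra.
pose A : set R := range (fun j => u j - e j).
have A0 : A !=set0 by exists (u 0%N - e 0%N); exists 0%N.
have Ab m : ubound A (u m + e m) by move=> _ [j _ <-]; exact: cmp.
exists (sup A) => j; rewrite -/(e j).
have h1 : sup A <= u j + e j by apply: sup_le_ub.
have h2 : u j - e j <= sup A.
  by apply: sup_upper_bound; [split => //; exists (u 0%N + e 0%N)|exists j].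
by rewrite ler_norml; apply/andP; split; lra.
Qed.

(** * Existence and continuous dependence for a globally Lipschitz field *)

Lemma lipschitz_row_continuous (R : realType) n (g : 'rV[R]_n -> 'rV[R]_n) (k : R) :
  0 < k -> (forall u v, `|g u - g v| <= k * `|u - v|) -> continuous g.
Proof.
move=> k0 lg u; apply/(@cvgrPdist_le _ _ _ (nbhs u)) => e e0.
have : nbhs u [set v | `|u - v| < e / k].
  by apply/row_nbhsP; exists (e / k) => //; rewrite divr_gt0.
apply: filterS => v /= uv.
by rewrite (le_trans (lg _ _))// mulrC -ler_pdivlMr// ltW.
Qed.

Lemma row_antiderivative (R : realType) n (h : R -> 'rV[R]_n) (p : 'rV[R]_n) :
  continuous h ->
  exists y : R -> 'rV[R]_n, y 0 = p /\ forall t : R, is_derive t 1 y (h t).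
Proof.
move=> ch.
have /choice[G hG] : forall i, exists G : R -> R,
    G 0 = 0 /\ forall t : R, is_derive t 1 G (h t 0 i).
  move=> i; apply: antiderivative => t.
  apply: (@continuous_comp _ _ _ h (fun M : 'rV[R]_n => M 0 i)); first exact: ch.
  exact: coord_continuous.
exists (fun t => \row_i (p 0 i + G i t)); split.
  by apply/rowP => i; rewrite mxE (hG i).1 addr0.
move=> t; apply/is_derive_rowP => i.
rewrite (_ : (fun _ => _) = cst (p 0 i) + G i); last first.
  by apply/funext => s; rewrite mxE.
by rewrite -[h t 0 i]add0r; apply: is_deriveD; exact: (hG i).2.
Qed.

Lemma row_dist_expR_derive (R : realType) n (x y dx dy : R -> 'rV[R]_n) (C k : R) :
  0 <= C -> 0 <= k -> x 0 = y 0 ->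
  (forall t : R, is_derive t 1 x (dx t)) -> (forall t : R, is_derive t 1 y (dy t)) ->
  (forall t, `|dx t - dy t| <= C * (k * expR (k * `|t|))) ->
  forall t, `|x t - y t| <= C * expR (k * `|t|).
Proof.
move=> C0 k0 xy0 hx hy h t; apply: norm_le_coord => [|i].
  by rewrite mulr_ge0// expR_ge0.
have := @ler_norm_expR_derive R (fun s => (x s - y s) 0 i)
  (fun s => (dx s - dy s) 0 i) C k C0 k0.
apply; first by rewrite xy0 subrr mxE.
- move=> s; have := is_deriveB (hx s) (hy s).
  by move/is_derive_rowP => /(_ i).
- by move=> s; rewrite (le_trans (coord_le_norm _ _)).
Qed.

(** Picard iteration: [P] sends [x] to the antiderivative of [g \o x] starting
from [p].  With the weight [expR (2 * k * `|t|)], twice the Lipschitz constant,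
each step halves the distance, so the iterates converge at a geometric rate,
locally uniformly in time, to a fixed point of [P]. *)
Lemma global_existence (R : realType) n (g : 'rV[R]_n -> 'rV[R]_n) (k : R) :
  0 < k -> (forall u v, `|g u - g v| <= k * `|u - v|) ->
  forall p, exists x : R -> 'rV[R]_n, x 0 = p /\ forall t : R, is_derive t 1 x (g (x t)).
Proof.
move=> k0 lg p.
have cg := lipschitz_row_continuous k0 lg.
have /choice[P hP] : forall x : R -> 'rV[R]_n, exists y : R -> 'rV[R]_n,
    continuous x -> y 0 = p /\ forall t : R, is_derive t 1 y (g (x t)).
  move=> x; have [cx|ncx] := pselect (continuous x); last by exists x.
  have [|y yP] := @row_antiderivative R n (g \o x) p; last by exists y.
  by move=> t; apply: continuous_comp; [exact: cx|exact: cg].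
have cP x : continuous x -> continuous (P x).
  by move=> /hP[_ h] t; have := is_derive_continuous (h t).
pose X j := iter j P (cst p).
have cX j : continuous (X j).
  by elim: j => [|j IH]; [exact: cst_continuous|exact: cP].
have hX j := hP _ (cX j).
have k20 : 0 <= 2 * k by lra.
(* [C] is the constant for which the speed [`|g p|] of the first iterate is
   at most [C * (2 * k * E t)]. *)
pose C := `|g p| / (2 * k); pose E (t : R) := expR (2 * k * `|t|).
have E0 t : 0 < E t by exact: expR_gt0.
have C0 : 0 <= C by rewrite divr_ge0.
have Cj j : 0 <= C / 2 ^+ j by rewrite divr_ge0// exprn_ge0.
have step j t : `|X j.+1 t - X j t| <= C * E t / 2 ^+ j.
  rewrite mulrAC; elim: j t => [|j IH] t.
    apply: (@row_dist_expR_derive _ _ _ _ (fun=> g p) (fun=> 0)) => //.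
    - exact: (hX 0%N).1.
    - exact: (hX 0%N).2.
    - move=> s; rewrite subr0 expr0 divr1.
      have -> : `|g p| = C * (2 * k) by rewrite divfK// mulf_neq0 ?gt_eqF// pnatr_eq0.
      have e1 : 1 <= expR (2 * k * `|s|) by rewrite -[leLHS]expR0 ler_expR mulr_ge0.
      by rewrite ler_wpM2l// ler_peMr.
  apply: (@row_dist_expR_derive _ _ _ _ (fun s => g (X j.+1 s)) (fun s => g (X j s))) => //.
  - exact: etrans (hX j.+1).1 (esym (hX j).1).
  - exact: (hX j.+1).2.
  - exact: (hX j).2.
  - move=> s; rewrite (le_trans (lg _ _))//.
    apply: (le_trans (ler_wpM2l (ltW k0) (IH s))).
    rewrite exprS invfM -/(E s) le_eqVlt; apply/orP; left; apply/eqP.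
    by field; rewrite expf_neq0.
have /choice[x hx] : forall t, exists v : 'rV[R]_n, forall j,
    `|X j t - v| <= 2 * (C * E t) / 2 ^+ j.
  move=> t.
  have /choice[l hl] : forall i, exists l, forall j,
      `|X j t 0 i - l| <= 2 * (C * E t) / 2 ^+ j.
    move=> i; apply: geometric_limit => j.
    have := coord_le_norm (X j.+1 t - X j t) i; rewrite !mxE => /le_trans; apply.
    exact: step.
  exists (\row_i l i) => j; apply: norm_le_coord.
    by rewrite -mulrA mulr_ge0// mulr_ge0 ?invr_ge0 ?exprn_ge0// mulr_ge0// ltW.
  by move=> i; rewrite !mxE.
have pow2 (M e : R) : 0 < e -> exists j, M / 2 ^+ j <= e.
  move=> e0; have h2 : `|2^-1| < 1 :> R by rewrite ger0_norm ?invr_ge0// invf_lt1// ltr1n.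
  have /cvgrPdist_le/(_ _ e0)[N _ /(_ N (leqnn N))] := @cvg_geometric R M 2^-1 h2.
  rewrite sub0r normrN => /(le_trans (ler_norm _)); rewrite /geometric/= exprVn.
  by exists N.
(* The convergence is uniform on [`|t| <= `|t0| + 1], whence continuity of the
   limit at [t0] by the usual three-term estimate. *)
have cx : continuous x.
  move=> t0; apply/cvgrPdist_le => e e0.
  have [j hj] := pow2 (2 * (C * expR (2 * k * (`|t0| + 1)))) (e / 3) (divr_gt0 e0 (ltr0n _ 3)).
  have close (t : R) : `|t| <= `|t0| + 1 -> `|X j t - x t| <= e / 3.
    move=> tt; apply: (le_trans (hx t j)); apply: le_trans hj.
    by rewrite ler_pM2r ?invr_gt0 ?exprn_gt0// ler_pM2l// ler_wpM2l// ler_expR ler_wpM2l.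
  near=> t.
  have tt0 : `|t0 - t| <= 1 by near: t; apply: cvgr_dist_le.
  have h1 : `|X j t0 - X j t| <= e / 3.
    by near: t; have /cvgrPdist_le := cX j t0; apply; rewrite divr_gt0.
  have h2 := close t0; have h3 := close t.
  have -> : x t0 - x t = (x t0 - X j t0) + (X j t0 - X j t) + (X j t - x t).
    by rewrite !subrKA.
  have -> : e = e / 3 + e / 3 + e / 3 by lra.
  apply: (le_trans (ler_normD _ _)); apply: lerD.
    apply: (le_trans (ler_normD _ _)); apply: lerD => //.
    by rewrite distrC; apply: h2; lra.
  by apply: h3; have := lerB_dist t t0; rewrite [`|t - t0|]distrC; lra.
have [y0 hy] := hP _ cx.
(* Both [x] and [P x] are within a multiple of [2 ^- j] of the iterates. *)
have xy : x = P x.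
  apply/funext => t; apply/eqP; rewrite -subr_eq0 -normr_le0.
  apply/ler_addgt0Pl => e e0; rewrite addr0.
  have [j hj] := pow2 (4 * (C * E t)) e e0.
  apply: le_trans hj.
  have h1 : `|X j.+1 t - P x t| <= C / 2 ^+ j * E t.
    apply: (@row_dist_expR_derive _ _ _ _ (fun s => g (X j s)) (fun s => g (x s))) => //.
    - exact: etrans (hX j).1 (esym y0).
    - exact: (hX j).2.
    - move=> s; rewrite (le_trans (lg _ _))//.
      apply: (le_trans (ler_wpM2l (ltW k0) (hx s j))).
      by rewrite -/(E s) le_eqVlt; apply/orP; left; apply/eqP; ring.
  have h2 := hx t j.+1.
  rewrite -(subrK (X j.+1 t) (x t)) -addrA (le_trans (ler_normD _ _))// distrC.
  apply: (le_trans (lerD h2 h1)); rewrite exprS invfM.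
  have : 0 <= C * E t / 2 ^+ j by rewrite mulrAC mulr_ge0// ltW.
  by set z := (2 ^+ j)^-1; nra.
by exists x; split => [|t]; rewrite {1}xy.
Unshelve. all: by end_near. Qed.

(** The supremum norm is not differentiable, but the sum of the squares of the
coordinates is, and it is comparable with the square of the norm. *)
Lemma ler_sqr_sum (R : realType) n (v : 'rV[R]_n) : `|v| ^+ 2 <= \sum_i v 0 i ^+ 2.
Proof.
have S0 : 0 <= \sum_i v 0 i ^+ 2 by apply: sumr_ge0 => i _; exact: sqr_ge0.
rewrite -[leRHS]sqr_sqrtr// ler_pXn2r ?nnegrE ?sqrtr_ge0//.
apply: norm_le_coord => [|i]; first exact: sqrtr_ge0.
rewrite -sqrtr_sqr ler_wsqrtr// (bigD1 i)//= lerDl.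
by apply: sumr_ge0 => j _; exact: sqr_ge0.
Qed.

Lemma sum_sqr_ler (R : realType) n (v : 'rV[R]_n) :
  \sum_i v 0 i ^+ 2 <= n%:R * `|v| ^+ 2.
Proof.
rewrite mulr_natl -[n in _ *+ n]card_ord -sumr_const; apply: ler_sum => i _.
by rewrite -real_normK ?num_real// ler_pXn2r ?nnegrE// coord_le_norm.
Qed.

(** Forward in time [expR (- K * u) * N u] is nonincreasing, and backward in
time the same role is played by [expR (K * u) * N u], which is nondecreasing. *)
Lemma ler_exp_growth (R : realType) (N dN : R -> R) (K : R) :
  (forall t : R, is_derive t 1 N (dN t)) -> (forall t, `|dN t| <= K * N t) ->
  forall s t, N t <= expR (K * `|t - s|) * N s.
Proof.
move=> hN bN s t.
have hE (c u : R) : is_derive u 1 (fun u => expR (c * u) * N u)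
    (expR (c * u) * (c * N u + dN u)).
  have h : is_derive u 1 (fun u => expR (c * u)) (expR (c * u) * c).
    apply: (@is_derive1_comp R expR (fun s => c * s)).
    have := @is_deriveZ R _ _ id c u 1 1 _; rewrite /GRing.scale/= mulr1; exact.
  by apply: (is_derive_eq (is_deriveM h (hN u))); rewrite /GRing.scale/=; ring.
have cancel a b : expR (a * b) * expR (- a * b) = 1 :> R.
  by rewrite -expRD mulNr subrr expR0.
have [st|/ltW ts] := leP s t.
  rewrite ger0_norm ?subr_ge0//.
  have := @ler_increment _ _ (cst 0) _ (cst 0) s t st (fun u _ => hE (- K) u)
    (fun u _ => is_derive_cst _ _ _).
  rewrite !fctE subrr subr_le0 => /(_ _)/wrap[u _|].
    rewrite pmulr_rle0 ?expR_gt0//; move: (bN u); rewrite ler_norml; lra.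
  move=> /(ler_wpM2l (expR_ge0 (K * t))).
  by rewrite !mulrA cancel mul1r -expRD -[N t]mul1r mulNr -mulrBr.
rewrite ler0_norm ?subr_le0// opprB.
have := @ler_increment _ (cst 0) _ (cst 0) _ t s ts
    (fun u _ => is_derive_cst _ _ _) (fun u _ => hE K u).
rewrite !fctE subrr subr_ge0 => /(_ _)/wrap[u _|].
  rewrite pmulr_rge0 ?expR_gt0//; move: (bN u); rewrite ler_norml; lra.
move=> /(ler_wpM2l (expR_ge0 (- K * t))).
rewrite !mulrA [X in X * N t]mulrC cancel mul1r -expRD => /le_trans; apply.
by rewrite le_eqVlt; apply/orP; left; apply/eqP; congr (expR _ * _); ring.
Qed.

(** The estimate holds with [s] and [t] in either order.  With [x s = y s] it is
uniqueness, with [y] constant it bounds how fast an equilibrium is approached or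
left, and in general it is continuous dependence on the initial point. *)
Lemma gronwall (R : realType) n (g : 'rV[R]_n -> 'rV[R]_n) (k : R) (x y : R -> 'rV[R]_n) :
  0 < k -> (forall u v, `|g u - g v| <= k * `|u - v|) ->
  (forall t : R, is_derive t 1 x (g (x t))) ->
  (forall t : R, is_derive t 1 y (g (y t))) ->
  forall s t, `|x t - y t| ^+ 2 <=
    expR (2 * n%:R * k * `|t - s|) * (n%:R * `|x s - y s| ^+ 2).
Proof.
move=> k0 lg hx hy s t.
pose N (u : R) := \sum_i (x u - y u) 0 i ^+ 2.
pose dN (u : R) := \sum_i (2 * (x u - y u) 0 i * (g (x u) - g (y u)) 0 i).
have hN (u : R) : is_derive u 1 N (dN u).
  have -> : N = \sum_i (fun u => (x u - y u) 0 i) ^+ 2.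
    by apply/funext => v; rewrite fct_sumE; apply: eq_bigr => i _; rewrite fctE.
  apply: is_derive_sum => i.
  have /is_derive_rowP/(_ i) h := is_deriveB (hx u) (hy u).
  have := @is_deriveX _ _ _ 2 _ _ _ h.
  by rewrite /= expr1.
apply: (le_trans (ler_sqr_sum _)); rewrite -/(N t).
apply: (@le_trans _ _ (expR (2 * n%:R * k * `|t - s|) * N s)); last first.
  by rewrite ler_wpM2l ?expR_ge0 ?sum_sqr_ler.
apply: (ler_exp_growth hN) => u.
rewrite (le_trans (ler_norm_sum _ _ _))//.
apply: (@le_trans _ _ (2 * n%:R * k * `|x u - y u| ^+ 2)); last first.
  by rewrite ler_wpM2l ?ler_sqr_sum// !mulr_ge0// ltW.
have -> : 2 * n%:R * k * `|x u - y u| ^+ 2 =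
    \sum_(i < n) (2 * `|x u - y u| * (k * `|x u - y u|)).
  by rewrite sumr_const card_ord -mulr_natl; ring.
apply: ler_sum => i _; rewrite 2!normrM ger0_norm//.
apply: ler_pM => //.
  by rewrite ler_wpM2l// coord_le_norm.
exact: le_trans (coord_le_norm _ _) (lg _ _).
Qed.

(** * Functions of class C1 along curves *)

Lemma is_derive_comp_partial (R : realType) n (V : normedModType R)
    (g : 'rV[R]_n -> V) (x : R -> 'rV[R]_n) (t : R) v :
  differentiable g (x t) -> is_derive t 1 x v ->
  is_derive t 1 (g \o x) (\sum_j v 0 j *: partial j g (x t)).
Proof.
move=> dg [dx xv].
have dx' : differentiable x t by apply/derivable1_diffP.
have dgx : differentiable (g \o x) t by exact: differentiable_comp.
split; first by apply/derivable1_diffP.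
have dxt : 'd x t 1 = v by rewrite -deriveE.
rewrite deriveE// diff_comp//= dxt.
rewrite [in LHS](row_sum_delta v) linear_sum; apply: eq_bigr => j _.
by rewrite linearZ/= /partial deriveE.
Qed.

Lemma is_derive_comp_orbital (R : realType) n (V : 'rV[R]_n -> R)
    (f : 'rV[R]_n -> 'rV[R]_n) (x : R -> 'rV[R]_n) (t : R) :
  differentiable V (x t) -> is_derive t 1 x (f (x t)) ->
  is_derive t 1 (V \o x) (orbital_derivative f V (x t)).
Proof.
move=> dV dx; have := is_derive_comp_partial dV dx.
congr is_derive; apply: eq_bigr => j _; rewrite mxE mulrC; exact.
Qed.

Lemma row_norm_increment (R : realType) n (x dx : R -> 'rV[R]_n) (c a b : R) :
  a <= b -> 0 <= c ->
  (forall t : R, a <= t <= b -> is_derive t 1 x (dx t)) ->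
  (forall t : R, a <= t <= b -> `|dx t| <= c) ->
  `|x b - x a| <= c * (b - a).
Proof.
move=> ab c0 hx bx; apply: norm_le_coord => [|i].
  by rewrite mulr_ge0// subr_ge0.
have hc (t : R) : a <= t <= b -> is_derive t 1 (c \*: id) (c *: 1).
  by move=> _; exact: is_deriveZ.
have hi (t : R) : a <= t <= b -> is_derive t 1 (fun s => x s 0 i) (dx t 0 i).
  by move=> /hx/is_derive_rowP.
have bi (t : R) : a < t < b -> `|dx t 0 i| <= c.
  move=> /andP[/ltW at_ /ltW tb]; rewrite (le_trans (coord_le_norm _ _))// bx//.
  exact/andP.
have h1 : x b 0 i - x a 0 i <= c * b - c * a.
  have := @ler_increment R (fun s => x s 0 i) (c \*: id) (fun s => dx s 0 i)
    (fun=> c *: 1) a b ab hi hc; apply => t tab.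
  by rewrite /GRing.scale/= mulr1 (le_trans (ler_norm _))// bi.
have h2 : - x b 0 i - - x a 0 i <= c * b - c * a.
  have := @ler_increment R (- (fun s => x s 0 i)) (c \*: id) (- (fun s => dx s 0 i))
    (fun=> c *: 1) a b ab (fun t tab => is_deriveN (hi t tab)) hc; apply => t tab.
  by rewrite /GRing.scale/= mulr1 (le_trans (ler_norm _))// normrN bi.
by rewrite !mxE ler_norml; apply/andP; split; lra.
Qed.

(** The partial derivatives are bounded near [0] by continuity, and the segment
joining two points of a ball stays in the ball, so the mean value inequality
along that segment applies. *)
Lemma C1_locally_lipschitz (R : realType) n (D : set 'rV[R]_n) (f : 'rV[R]_n -> 'rV[R]_n) :
  open D -> D 0 -> C1_on D f ->
  exists r k : R, [/\ 0 < r, 0 < k &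
    forall u v, `|u| <= r -> `|v| <= r -> `|f u - f v| <= k * `|u - v|].
Proof.
move=> oD D0 fC.
pose M j := `|partial j f 0| + 1.
have : nbhs (0 : 'rV[R]_n) (D `&` [set u | forall j, `|partial j f u| <= M j]).
  apply: filterI; first exact: open_nbhs_nbhs.
  apply: (@filter_forall _ _ (fun j u => `|partial j f u| <= M j)
    (nbhs (0 : 'rV[R]_n))) => j.
  have /= := (fC 0 D0).2 j => /cvgrPdist_le/(_ _ ltr01); apply: filterS => u /= h.
  have := lerB_dist (partial j f u) (partial j f 0).
  by rewrite distrC /M; lra.
move=> /row_nbhsP[e e0 he].
pose k := \sum_j M j + 1.
have k0 : 0 < k.
  by rewrite ltr_wpDl// sumr_ge0// => j _; rewrite addr_ge0.
have in_e (u : 'rV[R]_n) : `|u| <= e / 2 -> `|0 - u| < e by rewrite sub0r normrN; lra.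
exists (e / 2), k; split => //; first lra.
move=> u v ur vr.
pose x (t : R) := v + t *: (u - v).
have hx (t : R) : is_derive t 1 x (u - v).
  have h1 : is_derive t 1 (fun t : R => t *: (u - v)) (u - v).
    split; first by apply/derivable1_diffP; exact: differentiableZl.
    by rewrite deriveE// diffZl// diff_val scale1r.
  have := is_deriveD (is_derive_cst v t 1) h1.
  by rewrite add0r.
have xr (t : R) : 0 <= t <= 1 -> `|x t| <= e / 2.
  move=> /andP[t0 t1]; have -> : x t = (1 - t) *: v + t *: u.
    by rewrite /x scalerBr scalerBl scale1r -addrA [- _ + _]addrC.
  apply: (le_trans (ler_normD _ _)); rewrite !normrZ !ger0_norm//; last lra.
  nra.
have x1 : x 1 = u by rewrite /x scale1r addrC subrK.
have x0 : x 0 = v by rewrite /x scale0r addr0.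
have := @row_norm_increment R n (f \o x) 
  (fun t => \sum_j (u - v) 0 j *: partial j f (x t)) (k * `|u - v|) 0 1 ler01.
rewrite /= x1 x0 subr0 mulr1; apply.
- by rewrite mulr_ge0// ltW.
- move=> t /xr/in_e/he[Dx _].
  by apply: is_derive_comp_partial => //; exact: (fC _ Dx).1.
- move=> t /xr/in_e/he[_ Mx].
  apply: (le_trans (ler_norm_sum _ _ _)).
  apply: (@le_trans _ _ (\sum_j M j * `|u - v|)).
    apply: ler_sum => j _; rewrite normrZ mulrC; apply: ler_pM => //.
    exact: coord_le_norm.
  by rewrite -mulr_suml ler_wpM2r// /k lerDl.
Qed.

(** The truncation of every coordinate to [-r, r]: for the supremum norm it is
a 1-Lipschitz retraction onto the closed ball of radius [r]. *)
Definition clamp (R : realType) n (r : R) (u : 'rV[R]_n) : 'rV[R]_n :=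
  \row_i Num.max (- r) (Num.min r (u 0 i)).

Lemma clamp_le (R : realType) n (r : R) (u : 'rV[R]_n) : 0 <= r -> `|clamp r u| <= r.
Proof.
move=> r0; apply: norm_le_coord => // i; rewrite mxE ler_norml le_max lexx/=.
by rewrite ge_max ge_min lexx/=; lra.
Qed.

Lemma clamp_id (R : realType) n (r : R) (u : 'rV[R]_n) : `|u| <= r -> clamp r u = u.
Proof.
move=> ur; apply/rowP => i; rewrite mxE.
have : `|u 0 i| <= r by apply: le_trans ur; exact: coord_le_norm.
by rewrite ler_norml => /andP[h1 h2]; rewrite min_r// max_r.
Qed.

Lemma clamp_lipschitz (R : realType) n (r : R) (u v : 'rV[R]_n) : 0 <= r ->
  `|clamp r u - clamp r v| <= `|u - v|.
Proof.
move=> r0; apply: norm_le_coord => // i.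
apply: le_trans (coord_le_norm (u - v) i); rewrite !mxE.
rewrite !maxEle !minEle.
by do ![case: ifPn; rewrite -?ltNge]; move=> *; rewrite ler_norml;
  case: (ger0P (_ - _)); move=> *; apply/andP; split; lra.
Qed.

Lemma orbital_derivative_continuous (R : realType) n (D : set 'rV[R]_n)
    (f : 'rV[R]_n -> 'rV[R]_n) (V : 'rV[R]_n -> R) :
  C1_on D f -> C1_on D V -> forall u, D u ->
  {for u, continuous (orbital_derivative f V)}.
Proof.
move=> fC VC u Du.
have -> : orbital_derivative f V = \sum_j (fun u => partial j V u * f u 0 j).
  by apply/funext => w; rewrite fct_sumE; apply: eq_bigr => j _; rewrite mxE.
apply: (big_ind (fun h : 'rV[R]_n -> R => {for u, continuous h})) => [|h1 h2|j _].
- exact: cst_continuous.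
- exact: continuousD.
apply: continuousM; first exact: (VC u Du).2.
apply: (@continuous_comp _ _ _ f (fun M : 'rV[R]_n => M 0 j)).
  exact/differentiable_continuous/(fC u Du).1.
exact: coord_continuous.
Qed.

(** * Compactness and exit times *)

Lemma compact_lt0_bound (T : topologicalType) (R : realType) (h : T -> R) (K : set T) :
  compact K -> (forall u, K u -> {for u, continuous h}) ->
  (forall u, K u -> h u < 0) -> exists2 c, 0 < c & forall u, K u -> h u <= - c.
Proof.
move=> cK ch h0; have [K0|/set0P K0] := eqVneq K set0.
  by exists 1 => // u; rewrite K0.
have [|w wK hw] := compact_EVT_max K0 cK (f := h).
  by apply: continuous_in_subspaceT => u /set_mem; exact: ch.
exists (- h w); first by rewrite oppr_gt0 h0//; exact: set_mem.
by move=> u Ku; rewrite opprK hw// mem_set.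
Qed.

Lemma compact_le_bound (T : topologicalType) (R : realType) (h : T -> R) (K : set T) :
  compact K -> (forall u, K u -> {for u, continuous h}) ->
  exists M, forall u, K u -> `|h u| <= M.
Proof.
move=> cK ch; have [K0|/set0P K0] := eqVneq K set0.
  by exists 1 => // u; rewrite K0.
have [|w wK hw] := compact_EVT_max K0 cK (f := fun u => `|h u|).
  by apply: continuous_in_subspaceT => u /set_mem/ch hu; exact: cvg_norm.
by exists `|h w| => u Ku; rewrite hw// mem_set.
Qed.

(** The exit time is the infimum of the nonnegative times outside [O]; it is
itself outside [O] because [O] is open. *)
Lemma first_exit (R : realType) (O : set R) : open O -> O 0 ->
  (forall t, 0 <= t -> O t) \/
  exists T, [/\ 0 < T, ~ O T & forall s, 0 <= s < T -> O s].
Proof.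
move=> oO O0; have [|/existsNP[t0 /not_implyP[t00 nO]]]
  := pselect (forall t, 0 <= t -> O t); first by left.
right; pose A := [set t | 0 <= t /\ ~ O t].
have A0 : A !=set0 by exists t0.
have lA : has_lbound A by exists 0 => t [].
have hi : has_inf A by [].
have T0 : 0 <= inf A by apply: lb_le_inf => // t [].
have nOT : ~ O (inf A).
  move=> OT; have /nbhs_normP[e /= e0 he] : nbhs (inf A) O by exact: open_nbhs_nbhs.
  have [t At te] := inf_adherent e0 hi.
  have tT := ge_inf lA At.
  by apply: At.2; apply: he; rewrite /ball_/= distrC ger0_norm; lra.
exists (inf A); split => //.
  by rewrite lt_def T0 andbT; apply/eqP => e; apply: nOT; rewrite e.
move=> s /andP[s0 sT]; apply: contrapT => nOs.
by move: sT; rewrite ltNge (ge_inf lA).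
Qed.

Lemma closed_left_limit (R : realType) (T : topologicalType) (x : R -> T)
    (P : set T) (a b : R) :
  closed P -> a < b -> {for b, continuous x} ->
  (forall s, a <= s < b -> P (x s)) -> P (x b).
Proof.
move=> cP ab cx h; apply: cP => B /cx /nbhs_normP[e /= e0 he].
pose s := Num.max a (b - e / 2).
have sb : a <= s < b by rewrite /s le_max lexx/= gt_max ab/=; lra.
exists (x s); split; first exact: h.
have : b - e / 2 <= s by rewrite /s le_max lexx orbT.
by move=> ?; apply: he; rewrite /ball_/=; rewrite ger0_norm; lra.
Qed.

Lemma closed_norm_le (R : realType) n (r : R) : closed [set u : 'rV[R]_n | `|u| <= r].
Proof.
apply: (@closed_comp _ _ (fun u : 'rV[R]_n => `|u|) [set s | s <= r]).
  by move=> ? _; exact: norm_continuous.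
exact: closed_le.
Qed.

Lemma closed_ball_compact (R : realType) n (S : set 'rV[R]_n) (r : R) : closed S ->
  compact (S `&` [set u | `|u| <= r]).
Proof.
move=> cS; apply: bounded_closed_compact.
  exists r; split; first exact: num_real.
  by move=> M rM u [_ /= ur]; apply: le_trans ur (ltW rM).
by apply: closedI => //; exact: closed_norm_le.
Qed.

(** * The two functions along trajectories *)

(** On the compact part of [S] between the radii [e] and [r] the orbital
derivative of [V] is continuous and negative, hence at most some [- c < 0]. *)
Lemma lyapunov_rate (R : realType) n (D S : set 'rV[R]_n) (f : 'rV[R]_n -> 'rV[R]_n)
    (V : 'rV[R]_n -> R) (e r : R) :
  C1_on D f -> C1_on D V -> closed S -> S `<=` D ->
  (forall u, (S `\ 0) u -> orbital_derivative f V u < 0) -> 0 < e ->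
  exists2 c, 0 < c & forall (x : R -> 'rV[R]_n) (a b : R), a <= b ->
    (forall t : R, a <= t <= b -> is_derive t 1 x (f (x t))) ->
    (forall t : R, a <= t <= b -> S (x t) /\ e <= `|x t| <= r) ->
    V (x b) - V (x a) <= - c * (b - a).
Proof.
move=> fC VC cS SD dV e0.
pose K := (S `&` [set u | e <= `|u|]) `&` [set u | `|u| <= r].
have cK : compact K.
  apply: closed_ball_compact; apply: closedI => //.
  apply: (@closed_comp _ _ (fun u : 'rV[R]_n => `|u|) [set s | e <= s]).
    by move=> ? _; exact: norm_continuous.
  exact: closed_ge.
have K0 u : K u -> (S `\ 0) u.
  move=> [[Su /= eu] _]; split => // u0; move: eu; rewrite u0 normr0; lra.
have [|u Ku|c c0 hc] := @compact_lt0_bound _ R (orbital_derivative f V) K cK.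
- move=> u Ku; apply: (orbital_derivative_continuous fC VC).
  exact: SD Ku.1.1.
- exact/dV/K0.
exists c => // x a b ab hx xK.
have hV (t : R) : a <= t <= b -> is_derive t 1 (V \o x) (orbital_derivative f V (x t)).
  move=> tab; apply: is_derive_comp_orbital; last exact: hx.
  by apply: (VC _ _).1; apply: SD; apply: (xK _ tab).1.
have hc' (t : R) : a <= t <= b -> is_derive t 1 ((- c) \*: id) ((- c) *: 1).
  by move=> _; exact: is_deriveZ.
have := @ler_increment R (V \o x) ((- c) \*: id) (fun t => orbital_derivative f V (x t))
   (fun=> (- c) *: 1) a b ab hV hc'; rewrite /= mulrBr; apply => t /andP[/ltW a_t /ltW tb].
by rewrite /GRing.scale/= mulr1; apply: hc; have [|? /andP[? ?]] := xK t; first rewrite a_t.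
Qed.

(** Inside [U] and the ball, [W] cannot exceed its initial value [W (x 0) < 0].
If the orbit never left, it would therefore avoid a neighbourhood of [0], where
[W] is close to [0], and [V] would decrease linearly without bound.  At
the first exit time, [W < 0] rules out the boundary of [U], so the exit is
through the sphere. *)
Lemma exit_through_sphere (R : realType) n (D U : set 'rV[R]_n) (f : 'rV[R]_n -> 'rV[R]_n)
    (V W : 'rV[R]_n -> R) (r : R) (x : R -> 'rV[R]_n) :
  C1_on D f -> C1_on D V -> C1_on D W -> open U -> closure U `<=` D ->
  boundary U 0 ->
  (forall u, (closure U `\ 0) u -> orbital_derivative f V u < 0) ->
  (forall u, U u -> W u < 0) -> (forall u, boundary U u -> W u = 0) ->
  (forall u, U u -> orbital_derivative f W u <= 0) ->
  continuous x -> (forall t : R, `|x t| <= r -> is_derive t 1 x (f (x t))) ->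
  U (x 0) -> `|x 0| < r ->
  exists T, [/\ 0 < T, `|x T| = r & forall s, 0 <= s <= T -> U (x s) /\ `|x s| <= r].
Proof.
move=> fC VC WC oU UD bd0 dV W0 Wbd dW cx hx Ux0 x0r.
have clU : U `<=` closure U by exact: subset_closure.
pose P (u : 'rV[R]_n) := U u /\ `|u| < r.
have W_noninc T : 0 <= T -> (forall s, 0 <= s < T -> P (x s)) ->
    (forall s, 0 <= s <= T -> closure U (x s) /\ `|x s| <= r) -> W (x T) <= W (x 0).
  move=> T0 hP hcl.
  have hW (t : R) : 0 <= t <= T -> is_derive t 1 (W \o x) (orbital_derivative f W (x t)).
    move=> /hcl[cl tr]; apply: is_derive_comp_orbital; last exact: hx.
    by apply: (WC _ _).1; exact: UD.
  have := @ler_increment R (W \o x) (cst 0) _ (cst 0) 0 T T0 hW (fun t _ => is_derive_cst 0 t 1).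
  rewrite /= subrr subr_le0; apply => t /andP[/ltW t0 tT].
  by apply: dW; apply: (hP _ _).1; rewrite t0.
have oO : open [set t | P (x t)].
  have -> : [set t | P (x t)] = x @^-1` U `&` (fun t => `|x t|) @^-1` [set s | s < r] by [].
  apply: openI; first by apply: open_comp => // t _; exact: cx.
  apply: (@open_comp _ _ (fun t => `|x t|) [set s | s < r]); last exact: open_lt.
  by move=> t _; apply: cvg_norm; exact: cx.
have [hall|[T [T0 nPT hT]]] := first_exit oO (conj Ux0 x0r).
- exfalso.
  have W00 : W 0 = 0 by exact: Wbd.
  have cW0 : {for 0, continuous W}.
    by apply/differentiable_continuous/(WC _ _).1/UD; exact: bd0.1.
  have : nbhs (0 : 'rV[R]_n) [set u | W (x 0) < W u].
    have W0x : W (x 0) < W 0 by rewrite W00 W0.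
    exact: (@cvgr_gt _ _ (nbhs (0 : 'rV[R]_n)) _ W _ cW0 _ W0x).
  move=> /row_nbhsP[e e0 he].
  have [c c0 hc] := lyapunov_rate r fC VC (@closed_closure _ U) UD dV e0.
  have [M hM] : exists M, forall u, (closure U `&` [set u | `|u| <= r]) u -> `|V u| <= M.
    apply: compact_le_bound; first exact/closed_ball_compact/closed_closure.
    by move=> u [Uu _]; apply/differentiable_continuous/(VC _ _).1/UD.
  have hK t : 0 <= t -> (closure U `&` [set u | `|u| <= r]) (x t).
    by move=> /hall[/clU ? /ltW ?].
  have eT t : 0 <= t -> e <= `|x t|.
    move=> t0; rewrite leNgt; apply/negP => te.
    have : W (x 0) < W (x t) by apply: he; rewrite sub0r normrN.
    apply/negP; rewrite -leNgt; apply: W_noninc => // s /andP[s0 _]; first exact: hall.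
    by have [] := hK _ s0.
  have M0 : 0 <= M by apply: le_trans (hM _ (hK 0 (lexx _))).
  (* In time [T] the function [V] would drop by more than [2 * M], which is the
     largest possible variation of a function bounded by [M]. *)
  pose T := (2 * M + 1) / c.
  have T0 : 0 <= T by rewrite divr_ge0 ?(ltW c0)//; lra.
  have cT : c * T = 2 * M + 1 by rewrite /T mulrC divfK// gt_eqF.
  have := hc x 0 T T0; rewrite subr0 mulNr cT => h.
  have : V (x T) - V (x 0) <= - (2 * M + 1).
    apply: h => t /andP[t0 _]; have [Ut /= tr] := hK _ t0; first exact: hx.
    by rewrite tr eT.
  have := hM _ (hK _ T0); have := hM _ (hK _ (lexx _)).
  by rewrite !ler_norml => /andP[? ?] /andP[? ?]; lra.
have {}hT s : 0 <= s < T -> U (x s) /\ `|x s| < r by exact: hT.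
have clT : closure U (x T).
  apply: (@closed_left_limit _ _ x (closure U) 0 T) => //.
  - exact: closed_closure.
  - exact: cx.
  - by move=> s /hT[/clU].
have rT : `|x T| <= r.
  apply: (@closed_left_limit R R (fun t => `|x t|) [set s | s <= r] 0 T) => //.
  - by apply: cvg_norm; exact: cx.
  - by move=> s /hT[_ /ltW].
have hcl s : 0 <= s <= T -> closure U (x s) /\ `|x s| <= r.
  move=> /andP[s0]; rewrite le_eqVlt => /predU1P[->//|sT].
  by have [|/clU ? /ltW ?] := hT s; first exact/andP.
have UT : U (x T).
  apply: contrapT => nU.
  have : W (x T) = 0 by apply: Wbd; split => // /interior_subset.
  have := W_noninc T (ltW T0) hT hcl; have := W0 _ Ux0; lra.
exists T; split => //.
  by apply/eqP; rewrite eq_le rT leNgt; apply/negP => rT'; exact: nPT.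
move=> s /[dup]/hcl[_ sr] /andP[s0]; rewrite le_eqVlt => /predU1P[->//|sT].
by have [|? _] := hT s; first exact/andP.
Qed.

Lemma small_square (R : realType) (A e : R) : 0 <= A -> 0 < e ->
  exists2 d, 0 < d & A * d ^+ 2 < e ^+ 2.
Proof.
move=> A0 e0; have A1 : 0 < A + 1 by rewrite ltr_wpDl.
exists (e / (A + 1)); first exact: divr_gt0.
rewrite expr_div_n mulrA ltr_pdivrMr ?exprn_gt0// mulrC ltr_pM2l ?exprn_gt0//.
nra.
Qed.

(** Restarting the orbits of points [p] close to [0] from their exit points gives
points of the sphere whose backward orbits remain in [U] and in the ball for an
arbitrarily long time.  Any cluster point [y] of these exit points will do, since
each [phi y t] with [t <= 0] is then a limit of points of [U] in the ball. *)
Lemma backward_limit (R : realType) n (g : 'rV[R]_n -> 'rV[R]_n) (k r : R)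
    (phi : 'rV[R]_n -> R -> 'rV[R]_n) (U : set 'rV[R]_n) :
  0 < k -> (forall u v, `|g u - g v| <= k * `|u - v|) -> g 0 = 0 ->
  (forall p, phi p 0 = p /\ forall t : R, is_derive t 1 (phi p) (g (phi p t))) ->
  0 < r -> closure U 0 ->
  (forall p, U p -> `|p| < r -> exists T, [/\ 0 < T, `|phi p T| = r &
     forall s, 0 <= s <= T -> U (phi p s) /\ `|phi p s| <= r]) ->
  exists y, `|y| = r /\ forall t, t <= 0 -> closure U (phi y t) /\ `|phi y t| <= r.
Proof.
move=> k0 lg g0 hphi r0 U0 esc.
have gw p q (s t : R) := @gronwall R n g k (phi p) (phi q) k0 lg (hphi p).2 (hphi q).2 s t.
pose A (t : R) := expR (2 * n%:R * k * `|t|) * n%:R.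
have A0 t : 0 <= A t by rewrite mulr_ge0// expR_ge0.
pose Q u := U u /\ `|u| <= r.
have hy (m : nat) : exists y, `|y| = r /\ forall t, - m%:R <= t <= 0 -> Q (phi y t).
  have [d d0 hd] := small_square (A0 m%:R) r0.
  pose d' := Num.min d r.
  have d'0 : 0 < d' by rewrite lt_min d0.
  have [p [Up pd]] : U `&` [set u | `|0 - u| < d'] !=set0.
    by apply: U0; apply/row_nbhsP; exists d'.
  have {}pd : `|p| < d' by move: pd; rewrite /= sub0r normrN.
  have [pd1 pr] : `|p| < d /\ `|p| < r by move: pd; rewrite lt_min => /andP.
  have [T [T0 Tr hT]] := esc p Up pr.
  (* An orbit starting at distance [d'] from the equilibrium [0] cannot reach
     radius [r] before time [m]. *)
  have mT : m%:R <= T.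
    rewrite leNgt; apply/negP => Tm.
    have z (t : R) : is_derive t 1 (cst 0 : R -> 'rV[R]_n) (g (cst 0 t)).
      by rewrite g0; exact: is_derive_cst.
    have := @gronwall R n g k (phi p) (cst 0) k0 lg (hphi p).2 z 0 T.
    rewrite !subr0 Tr (hphi p).1 => h.
    suff : r ^+ 2 < r ^+ 2 by rewrite ltxx.
    apply: (le_lt_trans h); apply: le_lt_trans hd; rewrite mulrA.
    apply: ler_pM.
    - by rewrite mulr_ge0 ?expR_ge0.
    - exact: sqr_ge0.
    - rewrite ler_wpM2r// ler_expR ler_wpM2l ?mulr_ge0 ?(ltW k0)//.
      by rewrite !ger0_norm// ltW.
    - by rewrite ler_pXn2r ?nnegrE ?(ltW d0)// ltW.
  exists (phi p T); split => // t /andP[mt t0].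
  have -> : phi (phi p T) t = phi p (T + t).
    pose x2 (s : R) := phi p (T + s).
    have hx2 (s : R) : is_derive s 1 x2 (g (x2 s)).
      apply/is_derive_rowP => i.
      have /is_derive_rowP/(_ i) h := (hphi p).2 (T + s).
      have h1 : is_derive s 1 (fun s : R => T + s) 1.
        by have := is_deriveD (is_derive_cst T s 1) (is_derive_id s 1); rewrite add0r.
      have := @is_derive1_comp R (fun s => phi p s 0 i) (fun s : R => T + s) s _ _ h h1.
      by rewrite mulr1.
    have := @gronwall R n g k (phi (phi p T)) x2 k0 lg (hphi _).2 hx2 0 t.
    rewrite (hphi _).1 /x2 addr0 subrr normr0 expr0n/= !mulr0 => h.
    apply/eqP; rewrite -subr_eq0 -normr_eq0 -sqrf_eq0 eq_le h.
    exact: sqr_ge0.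
  by apply: hT; apply/andP; split; lra.
have /choice[y_ hy_] := hy.
have cS : compact (setT `&` [set u : 'rV[R]_n | `|u| <= r]).
  by apply: closed_ball_compact; exact: closedT.
pose F := y_ @ \oo.
have [|y [_ yF]] := cS F _.
  by exists 0%N => // m _; split => //=; rewrite (hy_ m).1.
have near_y (e : R) N : 0 < e -> exists m, (N <= m)%N /\ `|y - y_ m| < e.
  move=> e0; have [] := yF [set u | exists2 m, (N <= m)%N & u = y_ m] [set u | `|y - u| < e].
  - by exists N => // m /= Nm; exists m.
  - by apply/row_nbhsP; exists e.
  - by move=> _ [[m Nm ->] h]; exists m.
exists y; split.
  apply/eqP; rewrite -subr_eq0 -normr_le0; apply/ler_addgt0Pl => e e0; rewrite addr0.
  have [m [_ h]] := near_y e 0%N e0.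
  rewrite -(hy_ m).1; apply: le_trans (ltW h); exact: ler_dist_dist.
move=> t t0.
have cl : closure Q (phi y t).
  move=> B /row_nbhsP[e e0 he].
  have [d d0 hd] := small_square (A0 t) e0.
  have [N tN] : exists N : nat, - t <= N%:R.
    by exists (Num.bound (- t)); rewrite ltW// archi_boundP//; lra.
  have [m [Nm h]] := near_y d N d0.
  exists (phi (y_ m) t); split.
    apply: (hy_ m).2; rewrite t0 andbT.
    have : N%:R <= m%:R :> R by rewrite ler_nat.
    lra.
  apply: he; have := gw y (y_ m) 0 t; rewrite subr0 !(hphi _).1 mulrA => h1.
  rewrite -(@ltr_pXn2r _ 2) ?nnegrE ?(ltW e0)//.
  apply: (le_lt_trans h1); apply: le_lt_trans hd; rewrite ler_wpM2l ?A0//.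
  by rewrite ler_pXn2r ?nnegrE ?(ltW d0)// ltW.
split; first by apply: closure_subset cl => u [].
have : closure [set u : 'rV[R]_n | `|u| <= r] (phi y t) by apply: closure_subset cl => u [].
by move/(@closed_norm_le R n r).
Qed.

(** As [V (x t)] is monotone and bounded, it is within any [c] of its supremum
for all sufficiently negative [t].  But if [e <= `|x t|], then the orbit was
outside the ball of radius [d] throughout [t - 1, t], for some [d] depending
only on [e], and [V] lost a fixed amount [c] over that interval. *)
Lemma backward_convergence (R : realType) n (D S : set 'rV[R]_n)
    (f g : 'rV[R]_n -> 'rV[R]_n) (V : 'rV[R]_n -> R) (k r : R) (x : R -> 'rV[R]_n) :
  C1_on D f -> f 0 = 0 -> C1_on D V -> closed S -> S `<=` D ->
  (forall u, (S `\ 0) u -> orbital_derivative f V u < 0) ->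
  0 < k -> (forall u v, `|g u - g v| <= k * `|u - v|) -> g 0 = 0 ->
  (forall u, `|u| <= r -> g u = f u) ->
  (forall t : R, is_derive t 1 x (g (x t))) ->
  (forall t, t <= 0 -> S (x t) /\ `|x t| <= r) ->
  x t @[t --> -oo] --> (0 : 'rV[R]_n).
Proof.
move=> fC f0 VC cS SD dV k0 lg g0 gf hx xS.
have hxf (t : R) : t <= 0 -> is_derive t 1 x (f (x t)).
  by move=> /xS[_ /gf <-].
have dV0 u : S u -> orbital_derivative f V u <= 0.
  move=> Su; have [->|/eqP u0] := eqVneq u 0; last exact/ltW/dV.
  rewrite /orbital_derivative /dotp f0 big1// => j _; by rewrite !mxE mulr0.
have V_noninc (s t : R) : s <= t -> t <= 0 -> V (x t) <= V (x s).
  move=> st t0.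
  have hV (u : R) : s <= u <= t -> is_derive u 1 (V \o x) (orbital_derivative f V (x u)).
    move=> /andP[_ ut]; have u0 := le_trans ut t0.
    apply: is_derive_comp_orbital; last exact: hxf.
    by apply: (VC _ _).1; apply: SD; exact: (xS _ u0).1.
  have := @ler_increment R (V \o x) (cst 0) _ (cst 0) s t st hV (fun t _ => is_derive_cst 0 t 1).
  rewrite /= subrr subr_le0; apply => u /andP[_ /ltW ut].
  by apply: dV0; exact: (xS _ (le_trans ut t0)).1.
have [M hM] : exists M, forall u, (S `&` [set u | `|u| <= r]) u -> `|V u| <= M.
  apply: compact_le_bound; first exact/closed_ball_compact.
  by move=> u [Su _]; apply/differentiable_continuous/(VC _ _).1/SD.
pose B := [set V (x t) | t in [set t : R | t <= 0]].
have hB : has_sup B.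
  split; first by exists (V (x 0)); exists 0 => //=.
  exists M => _ [t /= t0 <-]; apply: le_trans (hM _ (xS _ t0)); exact: ler_norm.
apply/cvgrPdist_lt => e e0.
(* [A] is the constant of [gronwall] for a time lapse of at most one. *)
pose A := expR (2 * n%:R * k) * n%:R.
have A0 : 0 <= A by rewrite mulr_ge0// expR_ge0.
have [d d0 hd] := small_square A0 e0.
have [c c0 hc] := lyapunov_rate r fC VC cS SD dV d0.
have [_ [t0 /= t00 <-] ht0] := sup_adherent c0 hB.
exists t0; split; first exact: num_real.
move=> t tt0; rewrite sub0r normrN ltNge; apply/negP => et.
have t0' : t <= 0 by lra.
have h1 : V (x t0) <= V (x t) by apply: V_noninc => //; exact: ltW.
have h2 : V (x (t - 1)) <= sup B.
  by apply: sup_upper_bound => //; exists (t - 1) => //=; lra.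
have t1 : t - (t - 1) = 1 by lra.
suff : V (x t) - V (x (t - 1)) <= - c * (t - (t - 1)) by rewrite t1 mulr1; lra.
apply: hc; first lra.
  by move=> s /andP[_ st]; apply: hxf; lra.
move=> s /andP[s1 s2].
have [Ss sr] := xS s (le_trans s2 t0').
split => //; rewrite sr andbT leNgt; apply/negP => sd.
have z (u : R) : is_derive u 1 (cst 0 : R -> 'rV[R]_n) (g (cst 0 u)).
  by rewrite g0; exact: is_derive_cst.
have := @gronwall R n g k x (cst 0) k0 lg hx z s t.
rewrite !subr0; apply/negP; rewrite -ltNge.
apply: (@lt_le_trans _ _ (e ^+ 2)); last by rewrite ler_pXn2r ?nnegrE ?(ltW e0).
apply: le_lt_trans hd; rewrite mulrA; apply: ler_pM.
- by rewrite mulr_ge0 ?expR_ge0.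
- exact: sqr_ge0.
- rewrite ler_wpM2r// ler_expR -[leRHS]mulr1 ler_wpM2l ?mulr_ge0 ?(ltW k0)//.
  by rewrite ger0_norm; lra.
- by rewrite ler_pXn2r ?nnegrE ?(ltW d0)// ltW.
Qed.

(** * Existence of the trajectory *)

Theorem proposition7 (R : realType) (n : nat)
    (Delta : set 'rV[R]_n) (f : 'rV[R]_n -> 'rV[R]_n)
    (U : set 'rV[R]_n) (V W : 'rV[R]_n -> R)
    (Delta_open : open Delta) (Delta0 : Delta 0)
    (f_C1 : C1_on Delta f) (f0 : f 0 = 0)
    (U_open : open U) (clU_Delta : closure U `<=` Delta)
    (bdU0 : boundary U 0)
    (V_C1 : C1_on Delta V) (W_C1 : C1_on Delta W)
    (dV_lt0 : forall x : 'rV[R]_n,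
      (closure U `\ 0) x -> orbital_derivative f V x < 0)
    (W_lt0 : forall x : 'rV[R]_n, U x -> W x < 0)
    (W_eq0 : forall x : 'rV[R]_n, boundary U x -> W x = 0)
    (dW_le0 : forall x : 'rV[R]_n, U x -> orbital_derivative f W x <= 0) :
  exists x : R -> 'rV[R]_n,
    [/\ trajectory_on Delta f `]-oo, 0] x,
        exists s t : R, [/\ s <= 0, t <= 0 & x s <> x t]
      & x t @[t --> -oo] --> (0 : 'rV[R]_n)].
Proof.
have [r [k [r0 k0 flip]]] := C1_locally_lipschitz Delta_open Delta0 f_C1.
pose g u := f (clamp r u).
have glip u v : `|g u - g v| <= k * `|u - v|.
  apply: (le_trans (flip _ _ _ _)); rewrite ?clamp_le ?(ltW r0)//.
  by rewrite ler_wpM2l ?(ltW k0)// clamp_lipschitz ?(ltW r0).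
have gf u : `|u| <= r -> g u = f u by move=> ur; rewrite /g clamp_id.
have g0 : g 0 = 0 by rewrite gf ?normr0 ?(ltW r0).
have /choice[phi hphi] := global_existence k0 glip.
have [p Up pr|y [yr hy]] := backward_limit k0 glip g0 hphi r0 bdU0.1.
  have p0 := (hphi p).1.
  apply: (exit_through_sphere f_C1 V_C1 W_C1 U_open clU_Delta bdU0) => //; rewrite ?p0//.
    by move=> t; have := is_derive_continuous ((hphi p).2 t).
  by move=> t tr; rewrite -gf//; exact: (hphi p).2.
have y0 := (hphi y).1.
have cvg0 : phi y t @[t --> -oo] --> (0 : 'rV[R]_n).
  apply: (backward_convergence f_C1 f0 V_C1 (@closed_closure _ U) clU_Delta
    dV_lt0 k0 glip g0 gf _ hy).
  exact: (hphi y).2.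
exists (phi y); split => //.
- move=> t; rewrite in_itv/= => /hy[Ut tr]; split; first exact: clU_Delta.
  by rewrite -gf//; exact: (hphi y).2.
- have /cvgrPdist_lt/(_ _ r0)[T [_ hT]] := cvg0.
  pose t := Num.min 0 (T - 1).
  have t0 : t <= 0 by rewrite ge_min lexx.
  exists t, 0; split => // e.
  have : `|0 - phi y t| < r.
    by apply: hT; rewrite /t gt_min; apply/orP; right; lra.
  by rewrite sub0r normrN e y0 yr ltxx.
Qed.
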